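(* Let $A$ be a closed symmetric linear relation in a Hilbert space $\mathfrak H$, let $\Pi=\{\mathcal H,\Gamma_0,\Gamma_1\}$ be a boundary triplet for $A^*$, let $\tau\in\widetilde R_c(\mathcal H)$, let $\widetilde A=\widetilde A_\tau$ be the corresponding exit space self-adjoint extension of $A$ and let $S_{\widetilde A}(\lambda)$ be the Shtraus family of $\widetilde A$. Let $\tau_0\in R_c[\mathcal H_0]$ and $\mathcal K$ be the operator and multivalued parts of $\tau$, let $t\in\mathbb R$, and let $\mathcal B_{\tau_0}(t)\in B(\mathcal H_0)$ and $D_{\tau_0}(t):\operatorname{dom}D_{\tau_0}(t)\to\mathcal H_0$ ($\operatorname{dom}D_{\tau_0}(t)\subset\mathcal H_0$) be the operators $$\mathcal B_{\tau_0}(t)=s\text{-}\lim_{y\to0}\bigl(-iy\,\tau_0(t+iy)\bigr),$$ $$\operatorname{dom}D_{\tau_0}(t)=\Bigl\{h\in\mathcal H_0:\lim_{y\to0}\tfrac1y\operatorname{Im}(\tau_0(t+iy)h,h)<\infty\Bigr\},\qquad D_{\tau_0}(t)h=\lim_{y\to0}\tau_0(t+iy)h .$$ Assume also that $\operatorname{ran}\mathcal B_{\tau_0}(t)$ is closed. Then $S_{\widetilde A}(t)=A_{\eta(t)}=\{\widehat f\in A^*:\{\Gamma_0\widehat f,\Gamma_1\widehat f\}\in\eta(t)\}$, where $$\eta(t)=\eta_\tau(t)=\{\{h,-D_{\tau_0}(t)h+\mathcal B_{\tau_0}(t)h_0+\kappa\}:h\in\operatorname{dom}D_{\tau_0}(t),\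 h_0\in\mathcal H_0,\ \kappa\in\mathcal K\}.$$
   Context: Hilbert spaces are complex and separable; $B(\mathcal H)$ denotes bounded operators. A linear relation in $\mathcal H$ is a linear subspace $T\subset\mathcal H\oplus\mathcal H$ with elements $\{f,f'\}$; operators are identified with their graphs. $\operatorname{mul}T=\{f':\{0,f'\}\in T\}$, $T-\lambda=\{\{f,f'-\lambda f\}:\{f,f'\}\in T\}$, $-T=\{\{f,-f'\}\}$, $T^{-1}=\{\{f',f\}\}$, $T^*=\{\{g,g'\}:(f',g)=(f,g')\ \forall\{f,f'\}\in T\}$; $T$ is symmetric if $T\subset T^*$, self-adjoint if $T=T^*$. Boundary triplet for $A^*$: a Hilbert space $\mathcal H$ and linear maps $\Gamma_0,\Gamma_1:A^*\to\mathcal H$ such that $(\Gamma_0,\Gamma_1)^\top:A^*\to\mathcal H\oplus\mathcal H$ is surjective and $(f',g)-(f,g')=(\Gamma_1\widehat f,\Gamma_0\widehat g)-(\Gamma_0\widehat f,\Gamma_1\widehat g)$ for all $\widehat f=\{f,f'\},\widehat g=\{g,g'\}\in A^*$. For a relation $\theta$ in $\mathcal H$, $A_\theta=\{\widehat f\in A^*:\{\Gamma_0\widehat f,\Gamma_1\widehat f\}\in\theta\}$. $\widetilde R(\mathcal H)$: functions $\tau$ on $\mathbb C\setminus\mathbb R$ whose values are closed linear relations in $\mathcal H$ such that $\operatorname{Im}(f',f)\ge0$ for $\{f,f'\}\in\tau(\lambda)$, $\lambda\in\mathbb C_+$; $(\tau(\lambda)+i)^{-1}\in B(\mathcal H)$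 for $\lambda\in\mathbb C_+$ and is holomorphic there; $\tau^*(\lambda)=\tau(\bar\lambda)$. For $\tau\in\widetilde R(\mathcal H)$ the multivalued part $\mathcal K=\operatorname{mul}\tau(\lambda)$ is independent of $\lambda$, and with $\mathcal H_0=\mathcal H\ominus\mathcal K$ one has $\tau(\lambda)=\{\{h_0,\tau_0(\lambda)h_0+k\}:h_0\in\operatorname{dom}\tau_0(\lambda),k\in\mathcal K\}$; $\tau_0$ is the operator part of $\tau$ (its values are densely defined operators in $\mathcal H_0$). $R[\mathcal H_0]$: holomorphic $\tau_0:\mathbb C\setminus\mathbb R\to B(\mathcal H_0)$ with $\operatorname{Im}\lambda\cdot\operatorname{Im}\tau_0(\lambda)\ge0$, $\tau_0^*(\lambda)=\tau_0(\bar\lambda)$; $R_c[\mathcal H_0]$: those with $\operatorname{ran}\operatorname{Im}\tau_0(\lambda)$ closed for all $\lambda\in\mathbb C\setminus\mathbb R$. $\widetilde R_c(\mathcal H)$: those $\tau\in\widetilde R(\mathcal H)$ with $\tau_0\in R_c[\mathcal H_0]$. It is known that for $\tau_0\in R[\mathcal H_0]$ and $t\in\mathbb R$ the limits defining $\mathcal B_{\tau_0}(t)\ge0$ and $D_{\tau_0}(t)$ exist and define a bounded operator and a linear operator on a linear manifold, respectively. Exit space extension of $A$: a relation $\widetilde A=\widetilde A^*$ in a Hilbert space $\widetilde{\mathfrak H}\supset\mathfrak H$ with $A\subset\widetilde A$ and no nontrivial subspace of $\widetilde{\mathfrak H}\ominus\mathfrak H$ reducing $\widetilde A$; extensions unitarily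 equivalent via a unitary that is the identity on $\mathfrak H$ are identified. For each $\tau\in\widetilde R(\mathcal H)$, $\widetilde A_\tau$ is the unique exit space extension with $P_{\mathfrak H}(\widetilde A_\tau-\lambda)^{-1}|_{\mathfrak H}=(A_{-\tau(\lambda)}-\lambda)^{-1}$, $\lambda\in\mathbb C\setminus\mathbb R$. Shtraus family of $\widetilde A$: with $\mathfrak H_r=\widetilde{\mathfrak H}\ominus\mathfrak H$, $S_{\widetilde A}(\lambda)=\{\{f,f'\}\in\mathfrak H^2:\{f\oplus f_r,f'\oplus\lambda f_r\}\in\widetilde A\text{ for some }f_r\in\mathfrak H_r\}$, $\lambda\in\mathbb C$. *)

(* Defs.v *)
From HB Require Import structures.
From mathcomp Require Import all_boot all_order all_algebra complex.
From mathcomp Require Import all_classical all_reals all_analysis.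

Set Implicit Arguments.
Unset Strict Implicit.
Unset Printing Implicit Defensive.

Import Order.TTheory GRing.Theory Num.Theory.
Import numFieldNormedType.Exports.

Local Open Scope classical_set_scope.
Local Open Scope ring_scope.
Local Open Scope complex_scope.

Definition separable_space (T : topologicalType) : Prop :=
  exists2 D : set T, countable D & dense D.

(* Complex separable Hilbert spaces.  The norm of a normed module over [R[i]]
   takes its values in [R[i]]; it is the one induced by the inner product, which
   is linear in the first argument and conjugate-linear in the second one. *)
HB.mixin Record isSeparableHilbert (R : realType) (H : Type)
    of CompleteNormedModule R[i] H := {
  inner : {dot H for Num.conj} ;
  inner_normE : forall x : H, inner x x = `|x| ^+ 2 ;
  hilbert_separable : separable_space H }.

#[short(type="hilbertType")]
HB.structure Definition SeparableHilbert (R : realType) :=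
  {H of CompleteNormedModule R[i] H & isSeparableHilbert R H}.

Notation "''[' x , y ]" := (inner x y) : ring_scope.

Definition nonreal (R : realType) : set R[i] := [set l | complex.Im l != 0].

Definition upper_half (R : realType) : set R[i] := [set l | 0 < complex.Im l].

Definition linear_manifold (R : realType) (V : lmodType R[i]) (L : set V) : Prop :=
  L 0 /\ forall (a : R[i]) (x y : V), L x -> L y -> L (a *: x + y).

Definition orthocomplement (R : realType) (H : hilbertType R) (L : set H) : set H :=
  [set x | forall y, L y -> '[x, y] = 0].

(* An isometric embedding of [H'] into [H], through which [H'] is regarded as a
   closed subspace of [H]. *)
Definition hilbert_embedding (R : realType) (H' H : hilbertType R) (j : H' -> H) : Prop :=
  linear j /\ forall x y, '[j x, j y] = '[x, y].

Definition bounded_operator (R : realType) (H : hilbertType R) (F : H -> H) : Prop :=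
  linear F /\ exists M : R[i], forall x, `|F x| <= M * `|x|.

(* Holomorphy in the operator norm on an open set [U]. *)
Definition operator_holomorphic (R : realType) (H : hilbertType R)
    (U : set R[i]) (F : R[i] -> H -> H) : Prop :=
  forall l, U l -> exists2 G : H -> H, bounded_operator G &
    forall e : R[i], 0 < e -> \forall m \near (l : R[i]^o)^',
      forall h : H, `|(m - l)^-1 *: (F m h - F l h) - G h| <= e * `|h|.

(* A linear relation in [H] is a set of pairs [(f, f')] which is a linear
   manifold of [H * H]; the topology of [H * H] is that of the direct sum. *)
Definition graph_of (R : realType) (H : hilbertType R) (F : H -> H) : set (H * H) :=
  [set f | f.2 = F f.1].

Definition relmul (R : realType) (H : hilbertType R) (T : set (H * H)) : set H :=
  [set f' | T (0, f')].

Definition relran (R : realType) (H : hilbertType R) (T : set (H * H)) : set H :=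
  [set f.2 | f in T].

Definition relsub (R : realType) (H : hilbertType R) (T : set (H * H)) (l : R[i]) :
  set (H * H) := [set (f.1, f.2 - l *: f.1) | f in T].

Definition relopp (R : realType) (H : hilbertType R) (T : set (H * H)) : set (H * H) :=
  [set (f.1, - f.2) | f in T].

Definition relinv (R : realType) (H : hilbertType R) (T : set (H * H)) : set (H * H) :=
  [set (f.2, f.1) | f in T].

Definition reladj (R : realType) (H : hilbertType R) (T : set (H * H)) : set (H * H) :=
  [set g | forall f, T f -> '[f.2, g.1] = '[f.1, g.2]].

Definition symmetric_relation (R : realType) (H : hilbertType R) (T : set (H * H)) : Prop :=
  linear_manifold T /\ T `<=` reladj T.

Definition selfadjoint_relation (R : realType) (H : hilbertType R) (T : set (H * H)) : Prop :=
  linear_manifold T /\ T = reladj T.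

(* (F - F^* ) / 2i, with the adjoint taken in the sense of relations. *)
Definition imaginary_part (R : realType) (H : hilbertType R) (F : H -> H) : set (H * H) :=
  [set (g.1, (2%:R * 'i)^-1 *: (F g.1 - g.2)) | g in reladj (graph_of F)].

Definition boundary_triplet (R : realType) (H G : hilbertType R) (A : set (H * H))
    (Gam0 Gam1 : H * H -> G) : Prop :=
  [/\ forall (a : R[i]) f g, reladj A f -> reladj A g ->
        Gam0 (a *: f + g) = a *: Gam0 f + Gam0 g /\
        Gam1 (a *: f + g) = a *: Gam1 f + Gam1 g,
      forall h h' : G, exists f, [/\ reladj A f, Gam0 f = h & Gam1 f = h'] &
      forall f g, reladj A f -> reladj A g ->
        '[f.2, g.1] - '[f.1, g.2] =
        '[Gam1 f, Gam0 g] - '[Gam0 f, Gam1 g] ].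

(* The extension [A_theta]. *)
Definition triplet_extension (R : realType) (H G : hilbertType R) (A : set (H * H))
    (Gam0 Gam1 : H * H -> G) (theta : set (G * G)) : set (H * H) :=
  [set f | reladj A f /\ theta (Gam0 f, Gam1 f)].

(* The class [R~(H)]. *)
Definition nevanlinna_family (R : realType) (H : hilbertType R)
    (tau : R[i] -> set (H * H)) : Prop :=
  [/\ forall l, nonreal l -> linear_manifold (tau l) /\ closed (tau l),
      forall l f, upper_half l -> tau l f -> 0 <= complex.Im '[f.2, f.1],
      exists2 F : R[i] -> H -> H,
        forall l, upper_half l ->
          bounded_operator (F l) /\ relinv (relsub (tau l) (- 'i)) = graph_of (F l) &
        operator_holomorphic (@upper_half R) F &
      forall l, nonreal l -> reladj (tau l) = tau l^*].

(* The class [R[H]]. *)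
Definition nevanlinna_function (R : realType) (H : hilbertType R)
    (tau : R[i] -> H -> H) : Prop :=
  [/\ forall l, nonreal l -> bounded_operator (tau l),
      operator_holomorphic (@nonreal R) tau,
      forall l f, nonreal l -> imaginary_part (tau l) f ->
        0 <= (complex.Im l)%:C * '[f.2, f.1] &
      forall l, nonreal l -> reladj (graph_of (tau l)) = graph_of (tau l^*)].

(* The class [R_c[H]]. *)
Definition nevanlinna_function_c (R : realType) (H : hilbertType R)
    (tau : R[i] -> H -> H) : Prop :=
  nevanlinna_function tau /\
  forall l, nonreal l -> closed (relran (imaginary_part (tau l))).

(* [K] is the multivalued part of [tau], [j] identifies [H0] with the orthogonal
   complement of [K], and the values of [tau0] are (graphs of) the operator part
   of [tau]. *)
Definition family_parts (R : realType) (H H0 : hilbertType R)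
    (tau : R[i] -> set (H * H)) (K : set H) (j : H0 -> H)
    (tau0 : R[i] -> set (H0 * H0)) : Prop :=
  [/\ forall l, nonreal l -> relmul (tau l) = K,
      hilbert_embedding j,
      range j = orthocomplement K &
      forall l, nonreal l ->
        tau l = [set (j h.1, j h.2 + k) | h in tau0 l & k in K]].

(* [tau] belongs to [R~_c(H)], with multivalued part [K] and operator part
   [tau0] in [H0]. *)
Definition nevanlinna_family_c (R : realType) (H H0 : hilbertType R)
    (tau : R[i] -> set (H * H)) (K : set H) (j : H0 -> H)
    (tau0 : R[i] -> H0 -> H0) : Prop :=
  [/\ nevanlinna_family tau,
      family_parts tau K j (fun l => graph_of (tau0 l)) &
      nevanlinna_function_c tau0].

(* Meant for closed [L]; the parts of [T] in [L] and in its orthocomplement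
   must add up to [T]. *)
Definition reduces (R : realType) (H : hilbertType R) (L : set H) (T : set (H * H)) : Prop :=
  T = [set f + g | f in T `&` (L `*` L)
                 & g in T `&` (orthocomplement L `*` orthocomplement L)].

(* [At] is an exit space extension of [A] in a Hilbert space [Ht] containing [H]
   through [iota]. *)
Definition exit_space_extension (R : realType) (H Ht : hilbertType R) (iota : H -> Ht)
    (A : set (H * H)) (At : set (Ht * Ht)) : Prop :=
  [/\ hilbert_embedding iota,
      selfadjoint_relation At,
      forall f, A f -> At (iota f.1, iota f.2) &
      forall L : set Ht, linear_manifold L -> closed L ->
        L `<=` orthocomplement (range iota) -> reduces L At -> L = [set 0]].

(* [P_H T |_ H], where [P_H] is the orthogonal projection of [Ht] onto [H]. *)
Definition compression (R : realType) (H Ht : hilbertType R) (iota : H -> Ht)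
    (T : set (Ht * Ht)) : set (H * H) :=
  [set f | exists2 u, T (iota f.1, u) & orthocomplement (range iota) (u - iota f.2)].

(* [At] is the exit space extension of [A] which corresponds to [tau]. *)
Definition exit_extension_of (R : realType) (H G Ht : hilbertType R) (A : set (H * H))
    (Gam0 Gam1 : H * H -> G) (tau : R[i] -> set (G * G)) (iota : H -> Ht)
    (At : set (Ht * Ht)) : Prop :=
  exit_space_extension iota A At /\
  forall l, nonreal l ->
    compression iota (relinv (relsub At l)) =
    relinv (relsub (triplet_extension A Gam0 Gam1 (relopp (tau l))) l).

Definition shtraus_family (R : realType) (H Ht : hilbertType R) (iota : H -> Ht)
    (At : set (Ht * Ht)) (l : R[i]) : set (H * H) :=
  [set f | exists2 fr, orthocomplement (range iota) fr &
             At (iota f.1 + fr, iota f.2 + l *: fr)].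

Definition strong_limB (R : realType) (H : hilbertType R) (tau0 : R[i] -> H -> H) (t : R)
    (h : H) : H :=
  lim ((- ('i * y%:C)) *: tau0 (t +i* y) h @[y --> (0 : R)^']).

(* For nonzero y the quotient is nonnegative, even in y and nonincreasing in
   |y|, so that its limit exists in [0, +oo]; it is finite exactly when the
   quotient converges in [R]. *)
Definition dom_D (R : realType) (H : hilbertType R) (tau0 : R[i] -> H -> H) (t : R) :
  set H :=
  [set h | cvg (y^-1 * complex.Im '[tau0 (t +i* y) h, h] @[y --> (0 : R)^'])].

(* The value is only meaningful for [h] in [dom_D tau0 t]. *)
Definition limit_D (R : realType) (H : hilbertType R) (tau0 : R[i] -> H -> H) (t : R)
    (h : H) : H :=
  lim (tau0 (t +i* y) h @[y --> (0 : R)^']).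

Definition eta_relation (R : realType) (H H0 : hilbertType R) (K : set H) (j : H0 -> H)
    (tau0 : R[i] -> H0 -> H0) (t : R) : set (H * H) :=
  [set f | exists h h0 kappa, [/\ dom_D tau0 t h, K kappa &
     f = (j h, - j (limit_D tau0 t h) + j (strong_limB tau0 t h0) + kappa)]].

(* Main.v *)
Require Import Defs.
From mathcomp Require Import all_boot all_order all_algebra complex.
From mathcomp Require Import all_classical all_reals all_analysis.
From mathcomp Require Import ring lra.

Import Order.TTheory GRing.Theory Num.Theory.
Import numFieldNormedType.Exports.

Local Open Scope classical_set_scope.
Local Open Scope ring_scope.
Local Open Scope complex_scope.

(** Write every element of [At] as [(iota f + u, iota f' + u')] with [u], [u']
    orthogonal to the range of [iota].  Then [(f, f')] lies in the adjoint of
    [A], and the set [W] of all [(u, u', Gam0 f, - Gam1 f)] is a boundary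
    relation: Green's identity for the triplet and self-adjointness of [At] say
    exactly that [W] coincides with its own orthogonal complement for the
    indefinite form [(u',v) - (u,v') - (h',k) + (h,k')]
    ([exit_boundary_relation]).  In these terms [f] belongs to the Shtraus
    family at [l] iff some [(u, l u, Gam0 f, - Gam1 f)] belongs to [W], for
    every complex [l] ([shtraus_exit_relation]).  At a nonreal [l], comparing
    with the compressed resolvent gives elements [(u, l u, j h, j (tau0 l h))]
    of [W] for all [h], so the theorem becomes a statement on the boundary
    values at [t] of the Weyl function [tau0] of [W] ([eigenrelation]).

    Let [g y] be the vector [u] attached to [h] at [l = t + iy].  The form
    applied to a difference of two such elements gives
    [(y + s) |g y - g s|^2 = (s - y) (|g y|^2 - |g s|^2)], and a similar
    identity holds for [y g y].  An identity of this shape forces monotonicity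
    of the scalar function, and turns its convergence into convergence of the
    vectors, so the limits of resolvents are obtained without the spectral
    theorem:
    - [y g y] always converges as [y] tends to 0, which yields the limit [B h]
      of [- i y tau0 (t + iy) h] and an element [(r, t r, 0, j (B h))] of [W]
      ([residue_relation]);
    - [g y] converges as soon as it stays bounded, i.e. when [h] is in the
      domain of [D], which yields an element [(f, t f, j h, j (D h))]
      ([dom_D_relation]);
    - conversely an element [(f, t f, j h, h')] of [W] implies
      [|g y| <= |f|] ([relation_dom_D]).
    Subtracting, only elements [(f, t f, 0, h')] remain.  For these
    [(h', j k) = (f, r k)], [r k] being the residue vector of [k]; hence a
    component of [h'] in [H0] that is orthogonal to the range of [B] must
    vanish, and closedness of that range gives [h'] in [j (ran B) + K]
    ([eigen_boundary_values]). *)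

Set Implicit Arguments.
Unset Strict Implicit.

(** * Real and imaginary parts, limits of complex functions *)

Section ComplexParts.
Context {R : realType}.

Lemma RecD (u v : R[i]) : complex.Re (u + v) = complex.Re u + complex.Re v.
Proof. by case: u; case: v. Qed.

Lemma RecN (u : R[i]) : complex.Re (- u) = - complex.Re u.
Proof. by case: u. Qed.

Lemma ImcD (u v : R[i]) : complex.Im (u + v) = complex.Im u + complex.Im v.
Proof. by case: u; case: v. Qed.

Lemma ImcN (u : R[i]) : complex.Im (- u) = - complex.Im u.
Proof. by case: u. Qed.

Lemma Re_conjc (u : R[i]) : complex.Re u^* = complex.Re u.
Proof. by case: u. Qed.

Lemma Im_conjc (u : R[i]) : complex.Im u^* = - complex.Im u.
Proof. by case: u. Qed.

Lemma RecM (u v : R[i]) : complex.Re (u * v) =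
  complex.Re u * complex.Re v - complex.Im u * complex.Im v.
Proof. by case: u; case: v. Qed.

Lemma ImcM (u v : R[i]) : complex.Im (u * v) =
  complex.Re u * complex.Im v + complex.Im u * complex.Re v.
Proof. by case: u => a b; case: v => c d /=. Qed.

(** The squared modulus with values in [R]; the norm of [R[i]] is [R[i]]-valued. *)
Definition abs2 (u : R[i]) : R := complex.Re u ^+ 2 + complex.Im u ^+ 2.

Lemma abs2_ge0 (u : R[i]) : 0 <= abs2 u.
Proof. by rewrite addr_ge0// sqr_ge0. Qed.

Lemma abs2D_le (u v : R[i]) : abs2 (u + v) <= 2 * abs2 u + 2 * abs2 v.
Proof.
rewrite /abs2 !RecD !ImcD.
have := sqr_ge0 (complex.Re u - complex.Re v).
have := sqr_ge0 (complex.Im u - complex.Im v).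
by nra.
Qed.

Lemma abs2_lt (u : R[i]) (e : R) : 0 < e -> (`|u| < e%:C) = (abs2 u < e ^+ 2).
Proof.
move=> e0; rewrite normc_def ltcR -[X in _ = (X < _)](sqr_sqrtr (abs2_ge0 u)).
by rewrite ltr_pXn2r ?nnegrE ?sqrtr_ge0// ltW.
Qed.

Lemma cvg_abs2P {T : Type} {F : set_system T} {FF : Filter F} (f : T -> R[i]^o) (l : R[i]^o) :
  f x @[x --> F] --> l <->
  forall e : R, 0 < e -> \forall x \near F, abs2 (l - f x) < e.
Proof.
split=> [/cvgrPdist_lt h e e0|h].
  have se0 : 0 < Num.sqrt e by rewrite sqrtr_gt0.
  have := h (Num.sqrt e)%:C; rewrite ltcR => /(_ se0).
  by apply: filterS => x; rewrite abs2_lt// sqr_sqrtr// ltW.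
apply/cvgrPdist_lt => e e0.
have eE : e = (complex.Re e)%:C by rewrite RRe_real// gtr0_real.
move: e0; rewrite eE ltcR => e0.
have := h (complex.Re e ^+ 2) (exprn_gt0 _ e0).
by apply: filterS => x; rewrite abs2_lt.
Qed.

Lemma cvgC_unique {T : Type} {F : set_system T} {FF : ProperFilter F}
    (f : T -> R[i]^o) (a b : R[i]^o) :
  f x @[x --> F] --> a -> f x @[x --> F] --> b -> a = b.
Proof. by move=> fa fb; exact: (norm_cvg_unique fa fb). Qed.

Lemma dnbhs0_eq_cvg {V : topologicalType} (f g : R -> V) (l : V) :
  (forall y, y != 0 -> f y = g y) ->
  f y @[y --> (0 : R)^'] --> l -> g y @[y --> (0 : R)^'] --> l.
Proof.
move=> fg; apply: cvg_trans; apply: near_eq_cvg.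
have : \forall y \near (0 : R)^', y != 0 by exact: nbhs_dnbhs_neq.
by apply: filterS => y /fg ->.
Qed.

Lemma cvg_affine (a b : R[i]) :
  (a + b * y%:C : R[i]^o) @[y --> (0 : R)^'] --> (a : R[i]^o).
Proof.
apply/cvg_abs2P => e e0.
have b0 : 0 < abs2 b + 1 by rewrite ltr_wpDl ?abs2_ge0.
apply/nbhs_ballP; exists (Num.min 1 (e / (abs2 b + 1))) => /=.
  by rewrite lt_min ltr01 divr_gt0.
move=> y; rewrite -ball_normE /= sub0r normrN lt_min ltr_pdivlMr// => /andP[y1 ye] _.
rewrite opprD addrA subrr add0r.
have -> : abs2 (- (b * y%:C)) = abs2 b * `|y| ^+ 2.
  by rewrite /abs2 RecN ImcN RecM ImcM /= real_normK ?num_real//; ring.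
have := abs2_ge0 b; have := normr_ge0 y; nra.
Qed.

End ComplexParts.

(** * Real-valued squared norm of a Hilbert space *)

Section InnerProduct.
Context {R : realType} {H : hilbertType R}.
Implicit Types (x y z : H) (a : R[i]).

Lemma innerDl x y z : '[x + y, z] = '[x, z] + '[y, z].
Proof. exact: linearDl. Qed.

Lemma innerDr x y z : '[x, y + z] = '[x, y] + '[x, z].
Proof. exact: linearDr. Qed.

Lemma innerNl x y : '[- x, y] = - '[x, y].
Proof. exact: linearNl. Qed.

Lemma innerNr x y : '[x, - y] = - '[x, y].
Proof. exact: linearNr. Qed.

Lemma innerBl x y z : '[x - y, z] = '[x, z] - '[y, z].
Proof. exact: linearBl. Qed.

Lemma innerBr x y z : '[x, y - z] = '[x, y] - '[x, z].
Proof. exact: linearBr. Qed.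

Lemma innerZl a x y : '[a *: x, y] = a * '[x, y].
Proof. exact: linearZl_LR. Qed.

Lemma innerZr a x y : '[x, a *: y] = a^* * '[x, y].
Proof. exact: linearZr_LR. Qed.

Lemma inner0l x : '[0 : H, x] = 0.
Proof. exact: linear0l. Qed.

Lemma inner0r x : '[x, 0 : H] = 0.
Proof. exact: linear0r. Qed.

Lemma innerC x y : '[x, y] = '[y, x]^*.
Proof. by rewrite (hermC (@inner R H) x y) expr0 mul1r. Qed.

Lemma inner_subC x y z (w : H) : '[x, y] - '[z, w] = ('[y, x] - '[w, z])^*.
Proof.
rewrite (innerC x) (innerC z); apply/eqP.
by rewrite eq_complex !(RecD, RecN, ImcD, ImcN, Re_conjc, Im_conjc) opprD !eqxx.
Qed.

Definition sqnorm x : R := complex.Re '[x, x].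

Lemma sqnormE x : '[x, x] = (sqnorm x)%:C.
Proof.
rewrite /sqnorm RRe_real// inner_normE.
by apply: rpredX; exact: normr_real.
Qed.

Lemma sqnorm_normE x : `|x| = (Num.sqrt (sqnorm x))%:C.
Proof.
have : 0 <= `|x| by [].
move/ger0_real/RRe_real => hx.
have := inner_normE x; rewrite sqnormE -hx -rmorphXn/= => -[->].
rewrite sqrtr_sqr ger0_norm//.
by have : 0 <= `|x| by []; rewrite -hx lecR.
Qed.

Lemma sqnorm_ge0 x : 0 <= sqnorm x.
Proof.
by rewrite -lecR -sqnormE inner_normE exprn_ge0.
Qed.

Lemma sqnorm_eq0 x : sqnorm x = 0 -> x = 0.
Proof.
by move=> h; apply: normr0_eq0; rewrite sqnorm_normE h sqrtr0.
Qed.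

Lemma sqnorm0 : sqnorm (0 : H) = 0.
Proof. by rewrite /sqnorm inner0l. Qed.

Lemma sqnormN x : sqnorm (- x) = sqnorm x.
Proof. by rewrite /sqnorm innerNl innerNr opprK. Qed.

Lemma sqnorm_distC x y : sqnorm (x - y) = sqnorm (y - x).
Proof. by rewrite -sqnormN opprB. Qed.

Lemma sqnormD x y : sqnorm (x + y) = sqnorm x + sqnorm y + 2 * complex.Re '[x, y].
Proof.
rewrite /sqnorm innerDl !innerDr !RecD (innerC y x) Re_conjc; ring.
Qed.

Lemma sqnormB x y : sqnorm (x - y) = sqnorm x + sqnorm y - 2 * complex.Re '[x, y].
Proof. by rewrite sqnormD sqnormN innerNr RecN mulrN. Qed.

Lemma sqnormZ a x : sqnorm (a *: x) = (complex.Re a ^+ 2 + complex.Im a ^+ 2) * sqnorm x.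
Proof.
rewrite /sqnorm innerZl innerZr sqnormE !RecM !ImcM Re_conjc Im_conjc /=; ring.
Qed.

Lemma abs2_innerC x y : abs2 '[x, y] = abs2 '[y, x].
Proof. by rewrite innerC /abs2 Re_conjc Im_conjc sqrrN. Qed.

(** Pythagoras for the component of [x] orthogonal to [y], multiplied by
    [sqnorm y] so that the formula also holds for [y = 0].  It gives both the
    Cauchy-Schwarz inequality and the variational step of the projection
    theorem. *)
Lemma sqnorm_residual x y :
  sqnorm y * sqnorm (x - ((sqnorm y)^-1%:C * '[x, y]) *: y) =
  sqnorm x * sqnorm y - abs2 '[x, y].
Proof.
rewrite sqnormB sqnormZ innerZr.
have [/eqP y0|y0] := boolP (sqnorm y == 0).
  by rewrite (sqnorm_eq0 y0) inner0r sqnorm0 mul0r mulr0 /abs2 /=; ring.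
by rewrite !RecM !ImcM Re_conjc Im_conjc !RecM !ImcM /= /abs2; field.
Qed.

Lemma Cauchy_Schwarz x y : abs2 '[x, y] <= sqnorm x * sqnorm y.
Proof. by rewrite -subr_ge0 -sqnorm_residual mulr_ge0// sqnorm_ge0. Qed.

Lemma Re_inner_le x y : 2 * complex.Re '[x, y] <= sqnorm x + sqnorm y.
Proof. by have := sqnorm_ge0 (x - y); rewrite sqnormB; lra. Qed.

Lemma sqnormB_le x y z : sqnorm (x - z) <= 2 * sqnorm (x - y) + 2 * sqnorm (y - z).
Proof.
have -> : x - z = (x - y) + (y - z) by rewrite addrA subrK.
by rewrite sqnormD; have := Re_inner_le (x - y) (y - z); lra.
Qed.

Lemma norm_lt_sqnorm x (e : R) : 0 < e -> (`|x| < e%:C) = (sqnorm x < e ^+ 2).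
Proof.
move=> e0; rewrite sqnorm_normE ltcR -{1}(gtr0_norm e0) -sqrtr_sqr.
by rewrite ltr_sqrt// exprn_gt0.
Qed.

Lemma cvg_sqnormP {T : Type} {F : set_system T} {FF : Filter F} (f : T -> H) l :
  f x @[x --> F] --> l <->
  forall e : R, 0 < e -> \forall x \near F, sqnorm (l - f x) < e.
Proof.
split=> [/cvgrPdist_lt h e e0|h].
  have se0 : 0 < Num.sqrt e by rewrite sqrtr_gt0.
  have := h (Num.sqrt e)%:C; rewrite ltcR => /(_ se0).
  by apply: filterS => x; rewrite norm_lt_sqnorm// sqr_sqrtr// ltW.
apply/cvgrPdist_lt => e e0.
have eE : e = (complex.Re e)%:C by rewrite RRe_real// gtr0_real.
move: e0; rewrite eE ltcR => e0.
have := h (complex.Re e ^+ 2) (exprn_gt0 _ e0).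
by apply: filterS => x; rewrite norm_lt_sqnorm.
Qed.

Lemma sqnorm_cauchy_cvg {T : Type} {F : set_system T} {FF : ProperFilter F} (f : T -> H) :
  (forall e : R, 0 < e -> exists s : T, \forall r \near F, sqnorm (f s - f r) < e) ->
  cvg (f x @[x --> F]).
Proof.
move=> h; apply: cauchy_cvg; apply: cauchy_exP => e e0.
have eE : e = (complex.Re e)%:C by rewrite RRe_real// gtr0_real.
move: e0; rewrite eE ltcR => e0.
have [s hs] := h (complex.Re e ^+ 2) (exprn_gt0 _ e0).
exists (f s); apply: (@filterS _ F _ _ _ _ hs) => r hr.
by rewrite /= -ball_normE /= norm_lt_sqnorm.
Qed.

End InnerProduct.

(** * Projection theorem and limits along the imaginary direction *)

Section Limits.
Context {R : realType} {H : hilbertType R}.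

Lemma cvg_innerl {T : Type} {F : set_system T} {FF : Filter F} (f : T -> H) (l z : H) :
  f x @[x --> F] --> l -> ('[f x, z] : R[i]^o) @[x --> F] --> ('[l, z] : R[i]^o).
Proof.
move=> /cvg_sqnormP h; apply/cvg_abs2P => e e0.
have sz : 0 < sqnorm z + 1 by rewrite ltr_wpDl ?sqnorm_ge0.
have := h (e / (sqnorm z + 1)) (divr_gt0 e0 sz).
apply: filterS => x; rewrite ltr_pdivlMr// -innerBl => hx.
apply: le_lt_trans (Cauchy_Schwarz _ _) _; apply: le_lt_trans hx.
by rewrite ler_wpM2l ?sqnorm_ge0// lerDl.
Qed.

Lemma cvg_innerr {T : Type} {F : set_system T} {FF : Filter F} (f : T -> H) (l z : H) :
  f x @[x --> F] --> l -> ('[z, f x] : R[i]^o) @[x --> F] --> ('[z, l] : R[i]^o).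
Proof.
move=> fl; have /cvg_abs2P h : ('[f x, z] : R[i]^o) @[x --> F] --> ('[l, z] : R[i]^o).
  exact: cvg_innerl.
apply/cvg_abs2P => e e0.
have := h e e0; apply: filterS => x.
by rewrite -innerBl -innerBr abs2_innerC.
Qed.

Lemma parallelogram (x y : H) :
  sqnorm (x - y) + sqnorm (x + y) = 2 * sqnorm x + 2 * sqnorm y.
Proof. by rewrite sqnormB sqnormD; ring. Qed.

(** A minimizing filter of elements of [L] is Cauchy by the parallelogram law.
    An element of [L] whose squared distance to [x] exceeds the infimum by less
    than [e] is orthogonal to a given [z] up to [e * sqnorm z], so the limit is
    orthogonal to [z]. *)
Lemma orthogonal_decomposition (L : set H) (x : H) :
  linear_manifold L -> closed L -> exists2 y, L y & orthocomplement L (x - y).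
Proof.
move=> [L0 Llin] Lcl.
pose S := [set sqnorm (x - y) | y in L].
have Slb : has_inf S.
  split; first by exists (sqnorm (x - 0)), 0.
  by exists 0 => _ [y _ <-]; exact: sqnorm_ge0.
pose d := inf S.
have dle y : L y -> d <= sqnorm (x - y).
  by move=> Ly; apply: ge_inf; [case: Slb|exists y].
pose B (e : R) := [set y | L y /\ sqnorm (x - y) < d + e].
pose F := filter_from [set e : R | 0 < e] B.
have FF : ProperFilter F.
  apply: filter_from_proper.
    apply: filter_from_filter; first by exists 1 => /=.
    move=> e f /= e0 f0; exists (Num.min e f); first by rewrite lt_min e0.
    move=> y [Ly hy]; split; split=> //; apply: lt_le_trans hy _;
      by rewrite lerD2l ge_min lexx ?orbT.
  move=> e /= e0; have [_ [y Ly <-] hy] := inf_adherent e0 Slb.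
  by exists y.
have Bn e : 0 < e -> F (B e) by move=> e0; exists e.
have par e y z : B e y -> B e z -> sqnorm (y - z) < 4 * e.
  move=> [Ly hy] [Lz hz].
  have := parallelogram (x - y) (x - z).
  have -> : x - y - (x - z) = z - y by rewrite opprB addrC addrA subrK.
  have -> : x - y + (x - z) = 2%:R *: (x - 2%:R^-1 *: (y + z)).
    rewrite scalerBr scalerA divff ?pnatr_eq0// scale1r scaler_nat mulr2n.
    by rewrite opprD addrACA.
  rewrite sqnormZ /= sqnorm_distC.
  (* the midpoint is again in [L], hence not closer to [x] than [d] *)
  have Lm : L (2%:R^-1 *: (y + z)).
    rewrite scalerDr; apply: (Llin _ y) => //.
    by rewrite -[_ *: z]addr0; apply: (Llin _ z).
  have := dle _ Lm; set w := sqnorm (x - 2^-1 *: _) => dw.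
  have -> : (complex.Re (2 : R[i]) ^+ 2 + complex.Im (2 : R[i]) ^+ 2) = 4 :> R.
    by rewrite /=; ring.
  by lra.
have : cvg (id y @[y --> F]).
  apply: sqnorm_cauchy_cvg => e e0.
  have e4 : 0 < e / 4 by rewrite divr_gt0.
  have [s Bs] := filter_ex (Bn _ e4).
  exists s; apply: filterS (Bn _ e4) => r Br.
  by have := par _ _ _ Bs Br; rewrite mulrC divfK ?pnatr_eq0.
move=> /cvg_ex[y Fy]; exists y.
  apply: (closed_cvg L Lcl _ _ Fy).
  by apply: filterS (Bn 1 ltr01) => z [].
move=> z Lz.
(* [y' + a z] is in [L] for the optimal coefficient [a] *)
have key e y' : B e y' -> abs2 '[x - y', z] <= e * sqnorm z.
  move=> [Ly' hy']; have := sqnorm_residual (x - y') z.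
  set a := (_ * '[_, _]) => res.
  have : d <= sqnorm (x - (a *: z + y')) by apply: dle; exact: Llin.
  rewrite opprD addrCA addrC => da.
  have : sqnorm z * d <= sqnorm z * sqnorm (x - y' - a *: z).
    by rewrite ler_wpM2l ?sqnorm_ge0.
  have : sqnorm z * sqnorm (x - y') <= sqnorm z * (d + e).
    by rewrite ler_wpM2l ?sqnorm_ge0// ltW.
  by rewrite res; lra.
have abs20 : abs2 '[x - y, z] <= 0.
  apply/ler_addgt0Pl => e e0; rewrite addr0.
  have sz : 0 < sqnorm z + 1 by rewrite ltr_wpDl ?sqnorm_ge0.
  pose e' := e / (4 * (sqnorm z + 1)).
  have e'0 : 0 < e' by rewrite divr_gt0// mulr_gt0.
  have /cvg_sqnormP/(_ _ e'0) h := Fy.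
  have [y' [By' hy']] := filter_ex (filterI (Bn _ e'0) h).
  have k1 := key _ _ By'.
  have k2 := Cauchy_Schwarz (y' - y) z.
  have k3 : sqnorm (y' - y) * sqnorm z <= e' * sqnorm z.
    by rewrite ler_wpM2r ?sqnorm_ge0// sqnorm_distC ltW.
  have -> : x - y = (x - y') + (y' - y) by rewrite addrA subrK.
  rewrite innerDl.
  have k4 : 4 * (e' * sqnorm z) <= e.
    have -> : e = 4 * (e' * (sqnorm z + 1)) by rewrite /e'; field; exact: lt0r_neq0.
    by rewrite !ler_pM2l// lerDl.
  have := abs2D_le '[x - y', z] '[y' - y, z].
  by lra.
move: abs20; rewrite /abs2; set c := '[_, _] => c0.
have : (complex.Re c ^+ 2 == 0) && (complex.Im c ^+ 2 == 0).
  rewrite -paddr_eq0 ?sqr_ge0//; apply/eqP/le_anti; rewrite c0.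
  by rewrite addr_ge0 ?sqr_ge0.
rewrite !sqrf_eq0 => hc; apply/eqP; rewrite eq_complex; exact: hc.
Qed.

Lemma bounded_sqnorm (F : H -> H) : bounded_operator F ->
  exists2 C : R, 0 <= C & forall x, sqnorm (F x) <= C * sqnorm x.
Proof.
move=> [_ [c Fc]]; exists (complex.Re c ^+ 2); first exact: sqr_ge0.
move=> x; have := Fc x; rewrite !sqnorm_normE lecE => /andP[_].
rewrite RecM /= mulr0 subr0 => h.
have := ler_pM (sqrtr_ge0 _) (sqrtr_ge0 _) h h.
by rewrite -!expr2 exprMn !sqr_sqrtr ?sqnorm_ge0.
Qed.

(** When [|y| < |s|] the factors [y + s] and [s - y] are such that the identity
    reads [c y - c s = positive * sqnorm (g y - g s)], and [s = - y] gives
    [c (- y) = c y]; so [c] is even and nonincreasing in [|y|]. *)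
Lemma dnbhs0_cvg_of_bounded (g : R -> H) (c : R -> R) (M : R) :
  (forall y s, y != 0 -> s != 0 ->
    (y + s) * sqnorm (g y - g s) = (s - y) * (c y - c s)) ->
  (forall y, y != 0 -> c y <= M) ->
  cvg (c y @[y --> (0 : R)^']).
Proof.
move=> gc cM.
have mono y s : y != 0 -> s != 0 -> `|y| <= `|s| -> c s <= c y.
  move=> y0 s0; rewrite le_eqVlt => /predU1P[ys|ys].
    have [->//|ny] := eqVneq y s.
    have ysN : y = - s.
      by move/eqP: ys; rewrite eqr_norm2 (negbTE ny) => /eqP.
    have := gc _ _ y0 s0; rewrite {1 3}ysN addNr mul0r opprK => /esym/eqP.
    rewrite mulf_eq0 -mulr2n mulrn_eq0 (negbTE s0)/= subr_eq0 => /eqP ->//.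
  have := gc _ _ y0 s0; rewrite -(ler_pM2l (_ : 0 < (s - y) * (s + y))); last first.
    by rewrite -subr_sqr subr_gt0 -[y ^+ 2]real_normK ?num_real//
      -[s ^+ 2]real_normK ?num_real// ltr_sqr ?nnegrE.
  move=> h.
  rewrite -subr_ge0 -mulrBr mulrAC -h (addrC s) mulrAC -expr2.
  by rewrite mulr_ge0 ?sqr_ge0 ?sqnorm_ge0.
pose S := [set c y | y in [set y | y != 0]].
have hS : has_sup S.
  split; first by exists (c 1), 1 => //=; exact: oner_neq0.
  by exists M => _ [y /= y0 <-]; exact: cM.
apply/cvg_ex; exists (sup S); apply/cvgrPdist_lt => e e0.
have [_ [y /= y0 <-] hy] := sup_adherent e0 hS.
apply/nbhs_ballP; exists `|y| => /=; first by rewrite normr_gt0.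
move=> s; rewrite -ball_normE /= sub0r normrN => sy s0.
have := mono _ _ s0 y0 (ltW sy).
have : c s <= sup S by apply: ub_le_sup; [case: hS|exists s].
by rewrite ltr_norml; lra.
Qed.

(** For [y], [s] of the same sign the identity gives
    [sqnorm (g y - g s) <= |c y - c s|].  The two sides of [0] are linked by the
    case [y = - s / 2], where it reads [sqnorm (g y - g s) = 3 (c y - c s)]. *)
Lemma dnbhs0_cvg_of_cvg (g : R -> H) (c : R -> R) :
  (forall y s, y != 0 -> s != 0 ->
    (y + s) * sqnorm (g y - g s) = (s - y) * (c y - c s)) ->
  cvg (c y @[y --> (0 : R)^']) ->
  cvg (g y @[y --> (0 : R)^']).
Proof.
move=> gc /cvg_ex[l /cvgrPdist_lt cl]; apply: sqnorm_cauchy_cvg => e e0.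
have e16 : 0 < e / 16 by rewrite divr_gt0.
have /nbhs_ballP[d /= d0 hd] := cl _ e16.
have cd y : y != 0 -> `|y| < d -> `|l - c y| < e / 16.
  by move=> y0 yd; apply: hd => //; rewrite -ball_normE /= sub0r normrN.
have pos y s : 0 < y -> y < d -> 0 < s -> s < d -> sqnorm (g y - g s) < e / 8.
  move=> y0 yd s0 sd.
  have := cd y (lt0r_neq0 y0); rewrite gtr0_norm// => /(_ yd).
  have := cd s (lt0r_neq0 s0); rewrite gtr0_norm// => /(_ sd).
  rewrite !ltr_norml => /andP[s1 s2] /andP[y1 y2].
  rewrite -(ltr_pM2l (addr_gt0 y0 s0)) gc ?lt0r_neq0//.
  have [ys|ys] := leP y s; nra.
exists (d / 2); apply/nbhs_ballP; exists d => //= s.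
rewrite -ball_normE /= sub0r normrN => sd s0.
have d2 : 0 < d / 2 by lra.
have d2' : d / 2 < d by lra.
have [sp|sn] := ltP 0 s.
  by rewrite gtr0_norm// in sd; apply: lt_trans (pos _ _ d2 d2' sp sd) _; lra.
have {}sn : s < 0 by rewrite lt_neqAle s0.
rewrite ltr0_norm// in sd.
have s'0 : 0 < - s / 2 by lra.
have s'd : - s / 2 < d by lra.
have h1 := pos _ _ d2 d2' s'0 s'd.
have h2 : sqnorm (g (- s / 2) - g s) < 3 * (e / 8).
  have -> : sqnorm (g (- s / 2) - g s) = 3 * (c (- s / 2) - c s).
    have s20 : s / 2 != 0 by rewrite mulf_neq0// invr_eq0 pnatr_eq0.
    apply: (mulfI s20); rewrite [LHS](_ : _ = (- s / 2 + s) * sqnorm (g (- s / 2) - g s)).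
      by rewrite (gc _ _ (lt0r_neq0 s'0) s0); move: (c _ - c s) => w; field.
    by congr (_ * _); field.
  have := cd _ s0; rewrite ltr0_norm// => /(_ sd).
  have := cd _ (lt0r_neq0 s'0); rewrite gtr0_norm// => /(_ s'd).
  by rewrite !ltr_norml; lra.
by apply: le_lt_trans (sqnormB_le _ (g (- s / 2)) _) _; lra.
Qed.

End Limits.

(** * Boundary relations *)

Section BoundaryRelation.
Context {R : realType} {E G : hilbertType R}.

(** [W] equals its own orthogonal companion for an indefinite form, i.e. it is a
    unitary relation between Krein spaces, the first of them built on the
    orthogonal complement of [M].  The left-to-right direction is symmetry, the
    converse one is maximality. *)
Definition boundary_relation (M : set E) (W : E -> E -> G -> G -> Prop) : Prop :=
  forall u u' h h', W u u' h h' <->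
    [/\ orthocomplement M u, orthocomplement M u' &
      forall v v' k k', W v v' k k' ->
        '[u', v] - '[u, v'] = '[h', k] - '[h, k']].

Context {M : set E} {W : E -> E -> G -> G -> Prop}.
Hypothesis brW : boundary_relation M W.

Lemma boundary_relation_green u u' h h' v v' k k' :
  W u u' h h' -> W v v' k k' -> '[u', v] - '[u, v'] = '[h', k] - '[h, k'].
Proof. by move=> /brW[_ _]; exact. Qed.

Lemma boundary_relation_lin a u u' h h' v v' k k' :
  W u u' h h' -> W v v' k k' ->
  W (a *: u + v) (a *: u' + v') (a *: h + k) (a *: h' + k').
Proof.
move=> /brW[Mu Mu' Wu] /brW[Mv Mv' Wv]; apply/brW; split.
- by move=> z Mz; rewrite innerDl innerZl Mu// Mv// mulr0 addr0.
- by move=> z Mz; rewrite innerDl innerZl Mu'// Mv'// mulr0 addr0.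
move=> w w' m m' Ww; rewrite !innerDl !innerZl !opprD.
rewrite addrACA -mulrN -mulrDr (Wu _ _ _ _ Ww) (Wv _ _ _ _ Ww).
by rewrite [RHS]addrACA -[- (a * _)]mulrN -mulrDr.
Qed.

Lemma boundary_relation0 : W 0 0 0 0.
Proof.
by apply/brW; split=> [z _|z _|v v' k k' _]; rewrite ?inner0l ?subrr.
Qed.

Lemma boundary_relationZ a u u' h h' :
  W u u' h h' -> W (a *: u) (a *: u') (a *: h) (a *: h').
Proof.
by move=> Wu; have := boundary_relation_lin a Wu boundary_relation0; rewrite !addr0.
Qed.

Lemma boundary_relationB u u' h h' v v' k k' :
  W u u' h h' -> W v v' k k' -> W (u - v) (u' - v') (h - k) (h' - k').
Proof.
move=> Wu Wv; have := boundary_relation_lin (- 1) Wv Wu.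
by rewrite !scaleN1r !(addrC (- _)).
Qed.

Lemma orthocomplement_cvg {T : Type} {F : set_system T} {FF : ProperFilter F}
    (u : T -> E) l :
  (\forall y \near F, orthocomplement M (u y)) -> u y @[y --> F] --> l ->
  orthocomplement M l.
Proof.
move=> Mu ul z Mz.
have h : ('[u y, z] : R[i]^o) @[y --> F] --> ('[l, z] : R[i]^o) by exact: cvg_innerl.
have h0 : ('[u y, z] : R[i]^o) @[y --> F] --> (0 : R[i]^o).
  apply/cvg_abs2P => e e0; apply: filterS Mu => y My.
  by rewrite My// subr0 /abs2 /= expr0n addr0.
exact: (cvgC_unique h h0).
Qed.

(** Maximality makes [W] closed: Green's identity against a fixed element of [W]
    passes to the limit. *)
Lemma boundary_relation_cvg {T : Type} {F : set_system T} {FF : ProperFilter F}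
    (u u' : T -> E) (h h' : T -> G) l l' m m' :
  (\forall y \near F, W (u y) (u' y) (h y) (h' y)) ->
  u y @[y --> F] --> l -> u' y @[y --> F] --> l' ->
  h y @[y --> F] --> m -> h' y @[y --> F] --> m' -> W l l' m m'.
Proof.
move=> Wy ul ul' hm hm'; apply/brW; split.
- by apply: orthocomplement_cvg ul; apply: filterS Wy => y /brW[].
- by apply: orthocomplement_cvg ul'; apply: filterS Wy => y /brW[].
move=> v v' k k' Wv.
have c1 : ('[u' y, v] - '[u y, v'] : R[i]^o) @[y --> F] -->
    ('[l', v] - '[l, v'] : R[i]^o) by apply: cvgB; exact: cvg_innerl.
have c2 : ('[h' y, k] - '[h y, k'] : R[i]^o) @[y --> F] -->
    ('[m', k] - '[m, k'] : R[i]^o) by apply: cvgB; exact: cvg_innerl.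
apply: (cvgC_unique c1).
move: c2; apply: cvg_trans; apply: near_eq_cvg.
by apply: filterS Wy => y Wy; rewrite (boundary_relation_green Wy Wv).
Qed.

Lemma boundary_relation_Im u u' h' : W u u' 0 h' -> complex.Im '[u', u] = 0.
Proof.
move=> Wu; have := boundary_relation_green Wu Wu.
rewrite inner0r inner0l subrr (innerC u) => /(congr1 (@complex.Im R)).
by rewrite ImcD ImcN Im_conjc /=; lra.
Qed.

Lemma boundary_relation_nonreal0 (l : R[i]) u h' :
  nonreal l -> W u (l *: u) 0 h' -> u = 0.
Proof.
move=> /= l0 /boundary_relation_Im; rewrite innerZl sqnormE ImcM /= mulr0 add0r.
by move/eqP; rewrite mulf_eq0 (negbTE l0) => /eqP/sqnorm_eq0.
Qed.

End BoundaryRelation.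

(** * Isometric embeddings *)

Section Embedding.
Context {R : realType} {H' H : hilbertType R} {j : H' -> H}.
Hypothesis je : hilbert_embedding j.

Lemma embeddingD x y : j (x + y) = j x + j y.
Proof. by have := je.1 1 x y; rewrite !scale1r. Qed.

Lemma embedding0 : j 0 = 0.
Proof. by apply: (@addrI _ (j 0)); rewrite -embeddingD !addr0. Qed.

Lemma embeddingZ a x : j (a *: x) = a *: j x.
Proof. by have := je.1 a x 0; rewrite embedding0 !addr0. Qed.

Lemma embeddingN x : j (- x) = - j x.
Proof. by rewrite -[- x]scaleN1r embeddingZ scaleN1r. Qed.

Lemma embeddingB x y : j (x - y) = j x - j y.
Proof. by rewrite embeddingD embeddingN. Qed.

Lemma sqnorm_embedding x : sqnorm (j x) = sqnorm x.
Proof. by rewrite /sqnorm je.2. Qed.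

Lemma cvg_embedding {T : Type} {F : set_system T} {FF : Filter F} (f : T -> H') l :
  f y @[y --> F] --> l -> j (f y) @[y --> F] --> j l.
Proof.
move=> /cvg_sqnormP fl; apply/cvg_sqnormP => e e0.
by apply: filterS (fl e e0) => y; rewrite -embeddingB sqnorm_embedding.
Qed.

Lemma linear_manifold_embedding : linear_manifold (range j).
Proof.
split; first by exists 0 => //; exact: embedding0.
move=> a _ _ [x _ <-] [y _ <-]; exists (a *: x + y) => //; exact: je.1.
Qed.

(** Preimages of small balls around a point of the closure form a Cauchy
    filter, the embedding being isometric. *)
Lemma closed_embedding : closed (range j).
Proof.
move=> z zc.
pose B (e : R) := [set x | sqnorm (j x - z) < e].
pose F := filter_from [set e : R | 0 < e] B.
have FF : ProperFilter F.
  apply: filter_from_proper.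
    apply: filter_from_filter; first by exists 1 => /=.
    move=> e f /= e0 f0; exists (Num.min e f); first by rewrite lt_min e0.
    by move=> x; rewrite /B /= lt_min => /andP[].
  move=> e /= e0.
  have : nbhs z [set y | sqnorm (z - y) < e].
    by have /cvg_sqnormP := @cvg_id _ (nbhs z); exact.
  by move=> /zc[_ [[x _ <-] /=]]; rewrite sqnorm_distC => hx; exists x.
have Bn e : 0 < e -> F (B e) by move=> e0; exists e.
have : cvg (id x @[x --> F]).
  apply: sqnorm_cauchy_cvg => e e0.
  have e4 : 0 < e / 4 by rewrite divr_gt0.
  have [s Bs] := filter_ex (Bn _ e4).
  exists s; apply: filterS (Bn _ e4) => r; move: Bs; rewrite /B /= => Bs Br.
  rewrite -sqnorm_embedding embeddingB.
  apply: le_lt_trans (sqnormB_le _ z _) _; rewrite (sqnorm_distC z).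
  by lra.
move=> /cvg_ex[x Fx]; exists x => //.
apply: (norm_cvg_unique (cvg_embedding Fx)).
by apply/cvg_sqnormP => e e0; apply: filterS (Bn e e0) => y; rewrite sqnorm_distC.
Qed.

End Embedding.

(** * Boundary values of a Weyl function at a real point *)

Section WeylFunction.
Context {R : realType} {E G H0 : hilbertType R} {M : set E}
  {W : E -> E -> G -> G -> Prop} {j : H0 -> G} {tau0 : R[i] -> H0 -> H0}.
Hypothesis brW : boundary_relation M W.
Hypothesis je : hilbert_embedding j.
Hypothesis tau0_bounded : forall l, nonreal l -> bounded_operator (tau0 l).
Hypothesis Wtau0 : forall l h, nonreal l ->
  exists u, W u (l *: u) (j h) (j (tau0 l h)).

(** The gamma field of [W].  The vector is unique by
    [boundary_relation_nonreal0]; [0] is a default value for real [l]. *)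
Definition gamma_field (l : R[i]) (h : H0) : E :=
  xget 0 [set u | W u (l *: u) (j h) (j (tau0 l h))].

Lemma gamma_fieldP l h : nonreal l ->
  W (gamma_field l h) (l *: gamma_field l h) (j h) (j (tau0 l h)).
Proof. by move=> /(@Wtau0 _ h) ex; exact: (xgetPex 0 ex). Qed.

Lemma gamma_field_inner l m h k : nonreal l -> nonreal m ->
  (l - m^*) * '[gamma_field l h, gamma_field m k] =
  '[tau0 l h, k] - '[h, tau0 m k].
Proof.
move=> l0 m0.
have := boundary_relation_green brW (gamma_fieldP h l0) (gamma_fieldP k m0).
by rewrite innerZl innerZr !je.2 mulrBl.
Qed.

Lemma Im_tau0 l h : nonreal l ->
  complex.Im '[tau0 l h, h] = complex.Im l * sqnorm (gamma_field l h).
Proof.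
move=> l0; have := gamma_field_inner h h l0 l0.
rewrite sqnormE (innerC h) => /(congr1 (@complex.Im R)).
rewrite !(ImcM, RecD, RecN, ImcD, ImcN, Re_conjc, Im_conjc) /=.
lra.
Qed.

Lemma gamma_field_bounded l : 0 < complex.Im l ->
  exists2 C : R, 0 <= C & forall h,
    sqnorm (gamma_field l h) <= C * sqnorm h /\ sqnorm (tau0 l h) <= C * sqnorm h.
Proof.
move=> lp; have l0 : nonreal l by rewrite /nonreal /= lt0r_neq0.
have [C C0 tC] := bounded_sqnorm (tau0_bounded l0).
exists (C + (C + 1) / (2 * complex.Im l)).
  by rewrite addr_ge0// divr_ge0 ?mulr_ge0 ?addr_ge0// ltW.
move=> h; split; last first.
  apply: le_trans (tC h) _; rewrite ler_wpM2r ?sqnorm_ge0// lerDl.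
  by rewrite divr_ge0 ?mulr_ge0 ?addr_ge0// ltW.
apply: (@le_trans _ _ ((C + 1) / (2 * complex.Im l) * sqnorm h)); last first.
  by rewrite ler_wpM2r ?sqnorm_ge0// lerDr.
have p2 : 0 < 2 * complex.Im l by rewrite mulr_gt0.
rewrite mulrAC ler_pdivlMr// mulrC -mulrA -Im_tau0//.
have := Re_inner_le (- 'i *: tau0 l h) h.
rewrite innerZl RecM sqnormZ /=; have := tC h; lra.
Qed.

(** Green's identity for the difference of the elements at [l] and [m]: its
    third component is zero, so [boundary_relation_Im] applies. *)
Lemma gamma_field_Re_inner l m h : nonreal l -> nonreal m ->
  (complex.Im l + complex.Im m) * complex.Re '[gamma_field l h, gamma_field m h] +
  (complex.Re l - complex.Re m) * complex.Im '[gamma_field l h, gamma_field m h] =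
  complex.Im l * sqnorm (gamma_field l h) + complex.Im m * sqnorm (gamma_field m h).
Proof.
move=> l0 m0.
have := boundary_relationB brW (gamma_fieldP h l0) (gamma_fieldP h m0).
rewrite subrr => /(boundary_relation_Im brW).
rewrite innerBl !innerBr !innerZl !sqnormE.
rewrite (innerC (gamma_field m h)).
rewrite !(ImcM, RecM, RecD, RecN, ImcD, ImcN, Re_conjc, Im_conjc) /=.
lra.
Qed.

Context {t : R}.
Local Notation lam y := (t +i* y).
Local Notation gam y := (gamma_field (lam y)).

Lemma lam_nonreal y : y != 0 -> nonreal (lam y).
Proof. by []. Qed.

Lemma gamma_line_Re_inner y s h : y != 0 -> s != 0 ->
  (y + s) * complex.Re '[gam y h, gam s h] =
  y * sqnorm (gam y h) + s * sqnorm (gam s h).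
Proof.
move=> y0 s0; have := gamma_field_Re_inner h (lam_nonreal y0) (lam_nonreal s0).
by rewrite /= subrr mul0r addr0.
Qed.

(** On the vertical line through [t] the imaginary part of the mixed inner
    product drops out, which leaves an identity of the kind required by
    [dnbhs0_cvg_of_cvg]. *)
Lemma gamma_line_sqnormB y s h : y != 0 -> s != 0 ->
  (y + s) * sqnorm (gam y h - gam s h) =
  (s - y) * (sqnorm (gam y h) - sqnorm (gam s h)).
Proof.
move=> y0 s0; have := gamma_line_Re_inner h y0 s0; rewrite sqnormB => e.
by rewrite mulrBr mulrCA e; ring.
Qed.

Lemma scaled_gamma_line_sqnormB y s h : y != 0 -> s != 0 ->
  (y + s) * sqnorm (y%:C *: gam y h - s%:C *: gam s h) =
  (s - y) * (- (y ^+ 2 * sqnorm (gam y h)) - - (s ^+ 2 * sqnorm (gam s h))).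
Proof.
move=> y0 s0; have := gamma_line_Re_inner h y0 s0.
rewrite sqnormB !sqnormZ innerZl innerZr !(RecM, ImcM, Re_conjc, Im_conjc) /= => e.
rewrite !mul0r !oppr0 !mul0r !subr0 expr0n !addr0.
rewrite [LHS](_ : _ = (y + s) * (y ^+ 2 * sqnorm (gam y h) + s ^+ 2 * sqnorm (gam s h))
  - 2 * y * s * ((y + s) * complex.Re '[gam y h, gam s h])); last by ring.
by rewrite e; ring.
Qed.

(** Convergence of the gamma field carries over to [tau0]: up to the fixed
    bounded operators [gamma_field 'i] and [tau0 'i], Green's identity against
    the point [i] expresses [(c y) tau0 (t + iy) h] weakly through
    [(c y) gamma_field (t + iy) h] and [(c y) h].  Testing an increment against
    itself turns this into a norm estimate.  It is used with [c = 1] and with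
    [c y = - i y]. *)
Lemma tau0_line_cvg (c : R -> R[i]^o) (c0 : R[i]^o) (f : E) h :
  c y @[y --> (0 : R)^'] --> c0 ->
  c y *: gam y h @[y --> (0 : R)^'] --> f ->
  cvg (c y *: tau0 (lam y) h @[y --> (0 : R)^']).
Proof.
move=> cc cf.
have i0 : 0 < complex.Im ('i : R[i]) by rewrite /= ltr01.
have ni : nonreal ('i : R[i]) by rewrite /nonreal /= oner_neq0.
have [C C0 gC] := gamma_field_bounded i0.
pose v y := ((t%:C - ('i)^*) + 'i * y%:C) *: (c y *: gam y h).
pose w y := c y *: h.
have vE y : v y = (lam y - ('i)^*) *: (c y *: gam y h).
  congr (_ *: _); rewrite addrAC; congr (_ - _).
  by apply/eqP; rewrite eq_complex RecD ImcD RecM ImcM /=; apply/andP; split; apply/eqP; ring.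
(* Green's identity between [t + iy] and [i], multiplied by [c y] *)
have key y k : y != 0 ->
    '[c y *: tau0 (lam y) h, k] = '[v y, gamma_field 'i k] + '[w y, tau0 'i k].
  move=> y0; rewrite vE /w !innerZl.
  rewrite mulrCA (gamma_field_inner h k (lam_nonreal y0) ni).
  by rewrite mulrBr subrK.
have vc : v y @[y --> (0 : R)^'] --> (t%:C - ('i)^*) *: f.
  by apply: cvgZ cf; exact: cvg_affine.
have wc : w y @[y --> (0 : R)^'] --> c0 *: h by apply: cvgZr_tmp.
apply: sqnorm_cauchy_cvg => e e0.
pose e' := e / (16 * (C + 1)).
have C1 : 0 < C + 1 by rewrite ltr_wpDl.
have e'0 : 0 < e' by rewrite divr_gt0// mulr_gt0.
have /cvg_sqnormP/(_ _ e'0) v1 := vc.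
have /cvg_sqnormP/(_ _ e'0) w1 := wc.
have nz : \forall y \near (0 : R)^', y != 0 by exact: nbhs_dnbhs_neq.
have near1 : \forall y \near (0 : R)^',
    [/\ sqnorm ((t%:C - ('i)^*) *: f - v y) < e', sqnorm (c0 *: h - w y) < e' & y != 0].
  by near=> y; split; near: y.
have [s [vs ws s0]] := filter_ex near1.
exists s; apply: filterS near1 => y [vy wy y0].
set d := _ - _.
have hd : (sqnorm d)%:C =
    '[v s - v y, gamma_field 'i d] + '[w s - w y, tau0 'i d].
  by rewrite -sqnormE {1}/d innerBl !key// innerBl innerBl; ring.
have [g1 g2] := gC d.
have dv := sqnormB_le (v s) ((t%:C - ('i)^*) *: f) (v y).
have dw := sqnormB_le (w s) (c0 *: h) (w y).
rewrite (sqnorm_distC (v s) (_ *: f)) in dv; rewrite (sqnorm_distC (w s) (c0 *: h)) in dw.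
have cs1 := Cauchy_Schwarz (v s - v y) (gamma_field 'i d).
have cs2 := Cauchy_Schwarz (w s - w y) (tau0 'i d).
have dv' : sqnorm (v s - v y) <= 4 * e' by lra.
have dw' : sqnorm (w s - w y) <= 4 * e' by lra.
have := abs2D_le '[v s - v y, gamma_field 'i d] '[w s - w y, tau0 'i d].
rewrite -hd {1}/abs2 /= expr0n addr0 => sq.
have b1 : sqnorm (v s - v y) * sqnorm (gamma_field 'i d) <= 4 * e' * (C * sqnorm d).
  by apply: ler_pM => //; exact: sqnorm_ge0.
have b2 : sqnorm (w s - w y) * sqnorm (tau0 'i d) <= 4 * e' * (C * sqnorm d).
  by apply: ler_pM => //; exact: sqnorm_ge0.
have sq2 : sqnorm d ^+ 2 <= (16 * e' * C) * sqnorm d by lra.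
have [d0|d0] := eqVneq (sqnorm d) 0; first by rewrite d0.
have dp : 0 < sqnorm d by rewrite lt0r d0 sqnorm_ge0.
move: sq2; rewrite expr2 ler_pM2r// => sq2.
apply: le_lt_trans sq2 _.
have -> : e = 16 * e' * (C + 1) by rewrite /e'; field; exact: lt0r_neq0.
by rewrite mulrDr mulr1; lra.
Unshelve. all: by end_near. Qed.

Local Notation pole y := (- ('i * y%:C)).

Lemma cvg_pole : (pole y : R[i]^o) @[y --> (0 : R)^'] --> (0 : R[i]^o).
Proof.
have := @cvg_affine R 0 (- 'i).
by apply: dnbhs0_eq_cvg => y _; rewrite add0r mulNr.
Qed.

Lemma cvg_lam : (lam y : R[i]^o) @[y --> (0 : R)^'] --> (t%:C : R[i]^o).
Proof.
have := @cvg_affine R t%:C 'i.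
apply: dnbhs0_eq_cvg => y _; apply/eqP.
by rewrite eq_complex RecD ImcD RecM ImcM /=; apply/andP; split; apply/eqP; ring.
Qed.

(** Here [- |y gam y h|^2] plays the role of the scalar function: it is bounded
    above by [0], so convergence holds for every [h]. *)
Lemma pole_gamma_cvg h : cvg (pole y *: gam y h @[y --> (0 : R)^']).
Proof.
pose g (y : R) := y%:C *: gam y h.
pose c (y : R) := - (y ^+ 2 * sqnorm (gam y h)).
have gc y s : y != 0 -> s != 0 ->
    (y + s) * sqnorm (g y - g s) = (s - y) * (c y - c s).
  exact: scaled_gamma_line_sqnormB.
have c0 y : y != 0 -> c y <= 0.
  by move=> _; rewrite oppr_le0 mulr_ge0 ?sqr_ge0 ?sqnorm_ge0.
have /cvg_ex[f gf] := dnbhs0_cvg_of_cvg gc (dnbhs0_cvg_of_bounded gc c0).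
apply/cvg_ex; exists (- 'i *: f).
have : - 'i *: g y @[y --> (0 : R)^'] --> - 'i *: f by apply: cvgZl_tmp.
by apply: dnbhs0_eq_cvg => y _; rewrite scalerA mulNr.
Qed.

(** In terms of spectral theory, the projection of [gamma_field l h] onto the
    eigenspace at [t], up to a scalar factor depending on [l]. *)
Definition gamma_residue (h : H0) : E := lim (pole y *: gam y h @[y --> (0 : R)^']).

Lemma strong_limB_cvg h :
  pole y *: tau0 (lam y) h @[y --> (0 : R)^'] --> strong_limB tau0 t h.
Proof.
suff : cvg (pole y *: tau0 (lam y) h @[y --> (0 : R)^']) by [].
exact: (tau0_line_cvg cvg_pole (@pole_gamma_cvg h)).
Qed.

(** The elements of [W] at [t + iy], multiplied by [- i y], converge: the third
    component tends to [0], and the factor [t + iy] tends to [t]. *)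
Lemma residue_relation h :
  W (gamma_residue h) (t%:C *: gamma_residue h) 0 (j (strong_limB tau0 t h)).
Proof.
have r : pole y *: gam y h @[y --> (0 : R)^'] --> gamma_residue h.
  exact: pole_gamma_cvg.
apply: (boundary_relation_cvg brW (F := (0 : R)^')
  (u := fun y => pole y *: gam y h) (u' := fun y => lam y *: (pole y *: gam y h))
  (h := fun y => pole y *: j h) (h' := fun y => j (pole y *: tau0 (lam y) h))).
- have : \forall y \near (0 : R)^', y != 0 by exact: nbhs_dnbhs_neq.
  apply: filterS => y y0; rewrite scalerA [lam y * _]mulrC -scalerA (embeddingZ je).
  exact: (boundary_relationZ brW _ (gamma_fieldP _ (lam_nonreal y0))).
- exact: r.
- exact: (cvgZ cvg_lam r).
- by rewrite -[X in _ --> X](scale0r (j h)); apply: cvgZr_tmp; exact: cvg_pole.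
- by apply: cvg_embedding => //; exact: strong_limB_cvg.
Qed.

(** Green's identity between the given element and the one at [t + iy] reads
    [(h', j k) = (f, - i y gam y k)]. *)
Lemma eigen_residue f h' k : W f (t%:C *: f) 0 h' ->
  '[h', j k] = '[f, gamma_residue k].
Proof.
move=> Wf.
have c1 : ('[f, pole y *: gam y k] : R[i]^o) @[y --> (0 : R)^'] -->
    ('[f, gamma_residue k] : R[i]^o).
  by apply: cvg_innerr; exact: pole_gamma_cvg.
apply: cvgC_unique c1.
have : ('[h', j k] : R[i]^o) @[y --> (0 : R)^'] --> ('[h', j k] : R[i]^o).
  exact: cvg_cst.
apply: dnbhs0_eq_cvg => y y0.
have := boundary_relation_green brW Wf (gamma_fieldP k (lam_nonreal y0)).
rewrite inner0l subr0 => <-; rewrite !innerZl !innerZr -mulrBl; congr (_ * _).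
by apply/eqP; rewrite eq_complex /=; apply/andP; split; apply/eqP; ring.
Qed.

Lemma linear_manifold_strong_limB : linear_manifold (range (strong_limB tau0 t)).
Proof.
have lin a x y : strong_limB tau0 t (a *: x + y) =
    a *: strong_limB tau0 t x + strong_limB tau0 t y.
  have c1 := @strong_limB_cvg (a *: x + y).
  apply: (norm_cvg_unique c1).
  have : a *: (pole s *: tau0 (lam s) x) + pole s *: tau0 (lam s) y
      @[s --> (0 : R)^'] --> a *: strong_limB tau0 t x + strong_limB tau0 t y.
    by apply: cvgD; [apply: cvgZl_tmp|]; exact: strong_limB_cvg.
  apply: dnbhs0_eq_cvg => s s0.
  by rewrite (tau0_bounded (lam_nonreal s0)).1 scalerDr !scalerA mulrC.
split.
  exists 0 => //; have := lin (- 1) 0 0.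
  by rewrite scaler0 add0r => ->; rewrite scaleN1r addNr.
by move=> a _ _ [x _ <-] [y _ <-]; exists (a *: x + y).
Qed.

(** Split [h'] along [K], [j (range B)] and a rest [j m] with [m] orthogonal to
    the range of [B].  Since [(B m, m)] is the squared norm of the residue of
    [m], this residue is zero, and [eigen_residue] then forces
    [(m, m) = 0]. *)
Lemma eigen_boundary_values (K : set G) f h' :
  linear_manifold K -> closed K -> range j = orthocomplement K ->
  (forall k, K k -> W 0 0 0 k) ->
  closed (range (strong_limB tau0 t)) ->
  W f (t%:C *: f) 0 h' ->
  exists x k, K k /\ h' = j (strong_limB tau0 t x) + k.
Proof.
move=> Klin Kcl jK WK Bcl Wf.
have [k Kk] := orthogonal_decomposition h' Klin Kcl.
rewrite -jK => -[x _ jx].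
have [_ [b _ <-] Bperp] := orthogonal_decomposition x linear_manifold_strong_limB Bcl.
exists b, k; split=> //.
set m := x - _ in Bperp.
have h'E : h' - j (strong_limB tau0 t b) = j m + k.
  rewrite /m (embeddingB je) jx; move: (j _) => z.
  by rewrite addrAC subrK.
have Wd := boundary_relationB brW Wf (residue_relation b).
rewrite -scalerBr subr0 h'E in Wd.
have Pm : gamma_residue m = 0.
  have := eigen_residue m (residue_relation m); rewrite je.2 sqnormE => e.
  apply: sqnorm_eq0; have /(congr1 (@complex.Re R)) /= <- := e.
  by rewrite innerC Bperp//; exists m.
have : '[j m + k, j m] = 0 by rewrite (eigen_residue m Wd) Pm inner0r.
have km : '[k, j m] = 0.
  have : range j (j m) by exists m.
  by rewrite jK => /(_ _ Kk) e; rewrite innerC e conjc0.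
rewrite innerDl km addr0 je.2 sqnormE => /(congr1 (@complex.Re R)) /= /sqnorm_eq0 m0.
move/eqP: h'E; rewrite m0 (embedding0 je) add0r subr_eq => /eqP ->.
by rewrite addrC.
Qed.

Lemma dom_DP x : dom_D tau0 t x <-> cvg (sqnorm (gam y x) @[y --> (0 : R)^']).
Proof.
have e y : y != 0 -> y^-1 * complex.Im '[tau0 (lam y) x, x] = sqnorm (gam y x).
  by move=> y0; rewrite (Im_tau0 _ (lam_nonreal y0)) /= mulKf.
split=> /cvg_ex[l hl]; apply/cvg_ex; exists l; move: hl; apply: dnbhs0_eq_cvg => y y0.
  by rewrite e.
by rewrite e.
Qed.

(** The quotient in [dom_D] is the squared norm of the gamma field, so the gamma
    field converges, and with it [tau0]; the elements of [W] at [t + iy] converge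
    to the desired one. *)
Lemma dom_D_relation x : dom_D tau0 t x ->
  exists f, W f (t%:C *: f) (j x) (j (limit_D tau0 t x)).
Proof.
move=> /dom_DP cg.
have gc y s : y != 0 -> s != 0 -> (y + s) * sqnorm (gam y x - gam s x) =
    (s - y) * (sqnorm (gam y x) - sqnorm (gam s x)).
  exact: gamma_line_sqnormB.
have /cvg_ex[f gf] := dnbhs0_cvg_of_cvg gc cg.
exists f.
have tc : tau0 (lam y) x @[y --> (0 : R)^'] --> limit_D tau0 t x.
  have c1 : (1 : R[i]^o) @[_ --> (0 : R)^'] --> (1 : R[i]^o) by exact: cvg_cst.
  have c2 : (1 : R[i]^o) *: gam y x @[y --> (0 : R)^'] --> f.
    by move: gf; apply: dnbhs0_eq_cvg => y _; rewrite scale1r.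
  have /cvg_ex[l hl] := tau0_line_cvg c1 c2.
  suff : cvg (tau0 (lam y) x @[y --> (0 : R)^']) by [].
  apply/cvg_ex; exists l; move: hl; apply: dnbhs0_eq_cvg => y _.
  by rewrite scale1r.
apply: (boundary_relation_cvg brW (F := (0 : R)^')
  (u := fun y => gam y x) (u' := fun y => lam y *: gam y x)
  (h := fun=> j x) (h' := fun y => j (tau0 (lam y) x))).
- have : \forall y \near (0 : R)^', y != 0 by exact: nbhs_dnbhs_neq.
  by apply: filterS => y y0; exact: gamma_fieldP.
- exact: gf.
- exact: (cvgZ cvg_lam gf).
- exact: cvg_cst.
- exact: cvg_embedding.
Qed.

(** Green's identity for the difference with the element at [t + iy] gives
    [Re (gam y x, f) = |gam y x|^2], hence [|gam y x| <= |f|]; boundedness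
    suffices since the squared norm is monotone in [|y|]. *)
Lemma relation_dom_D f x h' : W f (t%:C *: f) (j x) h' -> dom_D tau0 t x.
Proof.
move=> Wf; apply/dom_DP.
apply: (@dnbhs0_cvg_of_bounded _ _ (fun y => gam y x) (fun y => sqnorm (gam y x)) (sqnorm f)).
  by move=> y s; exact: gamma_line_sqnormB.
move=> y y0.
have := boundary_relationB brW Wf (gamma_fieldP x (lam_nonreal y0)).
rewrite subrr => /(boundary_relation_Im brW).
rewrite innerBl !innerBr !innerZl !sqnormE (innerC f).
rewrite !(ImcM, RecM, RecD, RecN, ImcD, ImcN, Re_conjc, Im_conjc) /= => e.
have Ref : complex.Re '[gam y x, f] = sqnorm (gam y x).
  apply: (mulfI y0); lra.
by have := Re_inner_le (gam y x) f; rewrite Ref; lra.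
Qed.

(** The first component [h] is orthogonal to [K] by Green's identity against
    [(0, 0, 0, k)], hence lies in the range of [j]. *)
Lemma eigenrelation (K : set G) :
  linear_manifold K -> closed K -> range j = orthocomplement K ->
  (forall k, K k -> W 0 0 0 k) ->
  closed (range (strong_limB tau0 t)) ->
  forall h h', (exists f, W f (t%:C *: f) h h') <->
    exists x x0 k, [/\ dom_D tau0 t x, K k, h = j x &
      h' = j (limit_D tau0 t x) + j (strong_limB tau0 t x0) + k].
Proof.
move=> Klin Kcl jK WK Bcl h h'; split=> [[f Wf]|[x [x0 [k [Dx Kk -> ->]]]]].
  have : range j h.
    rewrite jK => k Kk.
    have := boundary_relation_green brW Wf (WK k Kk).
    by rewrite !inner0r subrr sub0r => /esym/eqP; rewrite oppr_eq0 => /eqP.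
  move=> [x _ xh]; rewrite -xh in Wf *.
  have Dx := relation_dom_D Wf.
  have [f1 Wf1] := dom_D_relation Dx.
  have := boundary_relationB brW Wf Wf1.
  rewrite subrr -scalerBr => /(eigen_boundary_values Klin Kcl jK WK Bcl).
  move=> [x0 [k [Kk e]]]; exists x, x0, k; split=> //.
  by rewrite -addrA -e addrC subrK.
have [f Wf] := dom_D_relation Dx.
exists (f + gamma_residue x0).
have := boundary_relation_lin brW 1 Wf (residue_relation x0).
rewrite !scale1r -scalerDr addr0 => /(boundary_relation_lin brW 1)/(_ (WK k Kk)).
by rewrite !scale1r !addr0.
Qed.

End WeylFunction.

(** * The boundary relation of an exit space extension *)

Section ExitSpace.
Context {R : realType} {H G Ht : hilbertType R} {A : set (H * H)}
  {Gam0 Gam1 : H * H -> G} {iota : H -> Ht} {At : set (Ht * Ht)}.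
Hypothesis trip : boundary_triplet A Gam0 Gam1.
Hypothesis iotae : hilbert_embedding iota.
Hypothesis sa : selfadjoint_relation At.
Hypothesis AAt : forall f, A f -> At (iota f.1, iota f.2).

(** The sign of [Gam1] is chosen so that [tau], rather than its opposite, is the
    Weyl family. *)
Definition exit_relation (u u' : Ht) (h h' : G) : Prop :=
  [/\ orthocomplement (range iota) u, orthocomplement (range iota) u' &
    exists f, [/\ reladj A f, Gam0 f = h, Gam1 f = - h' &
      At (iota f.1 + u, iota f.2 + u')]].

(** Pair an element of [At] with [(iota a.1, iota a.2)] for [a] in [A]. *)
Lemma exit_component_adj f u u' :
  orthocomplement (range iota) u -> orthocomplement (range iota) u' ->
  At (iota f.1 + u, iota f.2 + u') -> reladj A f.
Proof.
move=> Nu Nu'; rewrite sa.2 => Af a Aa.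
have := Af _ (AAt Aa); rewrite /= !innerDr !iotae.2.
rewrite (innerC _ u) (innerC _ u') Nu ?Nu'; [|by exists a.1|by exists a.2].
by rewrite conjc0 !addr0.
Qed.

Lemma inner_orthogonal_sum f g u v :
  orthocomplement (range iota) u -> orthocomplement (range iota) v ->
  '[iota f + u, iota g + v] = '[f, g] + '[u, v].
Proof.
move=> Nu Nv; rewrite !innerDl !innerDr iotae.2 (Nu (iota g)); last by exists g.
rewrite (innerC _ v) (Nv (iota f)); last by exists f.
by rewrite conjc0 addr0 add0r.
Qed.

(** It suffices to pair with an arbitrary element of the self-adjoint relation
    [At]; its components in the range of [iota] form an element of the adjoint
    of [A], to which the triplet's Green identity applies.  Note that [f] is any
    representative of its boundary values. *)
Lemma exit_relation_maximal f u u' :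
  reladj A f ->
  orthocomplement (range iota) u -> orthocomplement (range iota) u' ->
  (forall v v' k k', exit_relation v v' k k' ->
    '[u', v] - '[u, v'] = '[- Gam1 f, k] - '[Gam0 f, k']) ->
  At (iota f.1 + u, iota f.2 + u').
Proof.
move=> Af Nu Nu' max; rewrite sa.2 => -[q q'] Atq /=.
have dec z : exists g v, orthocomplement (range iota) v /\ z = iota g + v.
  have [_ [g _ <-] Ng] := orthogonal_decomposition z
    (linear_manifold_embedding iotae) (closed_embedding iotae).
  by exists g, (z - iota g); split=> //; rewrite addrC subrK.
have [g [v [Nv qE]]] := dec q; have [g' [v' [Nv' qE']]] := dec q'.
rewrite {}qE {}qE' in Atq *.
have Ag : reladj A (g, g') by exact: (exit_component_adj Nv Nv').
have Wg : exit_relation v v' (Gam0 (g, g')) (- Gam1 (g, g')).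
  by split=> //; exists (g, g'); rewrite opprK.
have [_ _ green] := trip.
have e1 := green _ _ Ag Af.
have e2 := max _ _ _ _ Wg.
rewrite !inner_orthogonal_sum//.
have {}e2 : '[v', u] - '[v, u'] = '[Gam0 (g, g'), Gam1 f] - '[Gam1 (g, g'), Gam0 f].
  rewrite inner_subC [RHS]inner_subC; congr conjc.
  by rewrite -[LHS]opprB e2 innerNl innerNr !opprK opprD !opprK.
by apply/eqP; rewrite -subr_eq0 opprD addrACA e1 e2 addrC -opprB addNr.
Qed.

Lemma exit_boundary_relation : boundary_relation (range iota) exit_relation.
Proof.
have [lin sur green] := trip.
move=> u u' h h'; split.
  move=> [Nu Nu' [f [Af f0 f1 Atf]]]; split=> // v v' k k'.
  move=> [Nv Nv' [g [Ag g0 g1 Atg]]].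
  have := Atg; rewrite sa.2 => /(_ _ Atf) /=.
  rewrite !inner_orthogonal_sum// => e.
  have := green _ _ Af Ag; rewrite f0 f1 g0 g1 innerNl innerNr opprK => e'.
  have eE (a b c d p q : R[i]) : a + b = c + d -> a - c = - p + q -> b - d = p - q.
    move=> h1 h2; have -> : b - d = (a + b) - (c + d) - (a - c) by ring.
    by rewrite h1 h2; ring.
  exact: eE e e'.
move=> [Nu Nu' max]; split=> //.
have [f [Af f0 f1]] := sur h (- h').
exists f; split=> //; apply: exit_relation_maximal => // v v' k k' /max ->.
by rewrite f0 f1 opprK.
Qed.

Lemma shtraus_exit_relation l f : shtraus_family iota At l f <->
  reladj A f /\ exists u, exit_relation u (l *: u) (Gam0 f) (- Gam1 f).
Proof.
have NZ u : orthocomplement (range iota) u -> orthocomplement (range iota) (l *: u).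
  by move=> Nu z Iz; rewrite innerZl Nu// mulr0.
split=> [[u Nu Atu]|[Af [u Wu]]].
  have Af := exit_component_adj Nu (NZ _ Nu) Atu.
  split=> //; exists u; split=> //; first exact: NZ.
  by exists f; rewrite opprK.
have [Nu _ _] := Wu; exists u => //.
apply: exit_relation_maximal => //; first exact: NZ.
by move=> v v' k k' Wv; rewrite (boundary_relation_green exit_boundary_relation Wu Wv).
Qed.

(** Lift [(h, - h')] to some [f] in the adjoint of [A].  Then [f] is in the
    extension given by the opposite of [tau l], and equality of the compressed
    resolvents puts it into the Shtraus family at [l]. *)
Lemma exit_relation_weyl (tau : R[i] -> set (G * G)) l h h' :
  compression iota (relinv (relsub At l)) =
    relinv (relsub (triplet_extension A Gam0 Gam1 (relopp (tau l))) l) ->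
  tau l (h, h') -> exists u, exit_relation u (l *: u) h h'.
Proof.
move=> comp tauh; have [_ sur _] := trip.
have [f [Af f0 f1]] := sur h (- h').
have : compression iota (relinv (relsub At l)) (f.2 - l *: f.1, f.1).
  rewrite comp; exists (f.1, f.2 - l *: f.1) => //; exists f => //; split=> //.
  by exists (h, h'); rewrite //= f0 f1.
move=> [w /= [_ [p Atp <-] /= [e pw]]]; rewrite -{}pw => Nw.
have Wf : shtraus_family iota At l f.
  exists (p.1 - iota f.1) => //.
  have -> : iota f.1 + (p.1 - iota f.1) = p.1 by rewrite addrC subrK.
  suff -> : iota f.2 + l *: (p.1 - iota f.1) = p.2 by rewrite -surjective_pairing.
  move/eqP: e; rewrite subr_eq (embeddingB iotae) (embeddingZ iotae) => /eqP ->.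
  by rewrite scalerBr addrA addrAC.
by have [_] := (shtraus_exit_relation l f).1 Wf; rewrite f0 f1 opprK.
Qed.

End ExitSpace.

Arguments exit_relation {R H G Ht} A Gam0 Gam1 iota At u u' h h'.

Unset Implicit Arguments.
Set Strict Implicit.

Theorem theorem3p3 (R : realType) (H G Ht H0 : hilbertType R)
    (A : set (H * H)) (Gam0 Gam1 : H * H -> G)
    (tau : R[i] -> set (G * G)) (K : set G) (j : H0 -> G) (tau0 : R[i] -> H0 -> H0)
    (iota : H -> Ht) (At : set (Ht * Ht)) (t : R) :
  symmetric_relation A -> closed A ->
  boundary_triplet A Gam0 Gam1 ->
  nevanlinna_family_c tau K j tau0 ->
  exit_extension_of A Gam0 Gam1 tau iota At ->
  closed (range (strong_limB tau0 t)) ->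
  shtraus_family iota At t%:C =
  triplet_extension A Gam0 Gam1 (eta_relation K j tau0 t).
Proof.
move=> _ _ trip [[tauC _ _ _] [Kmul je jK tauE] [[tau0_bd _ _ _] _]].
move=> [[iotae sa AAt _] comp] Bcl.
(* [K] is read off at the point [i], which shows that it is a closed subspace *)
have ni : nonreal ('i : R[i]) by rewrite /nonreal /= oner_neq0.
have [[tau00 tau_lin] tau_cl] := tauC _ ni.
have KE := Kmul _ ni.
have Klin : linear_manifold K.
  rewrite -KE; split=> // a x y tx ty.
  suff E : (0 : G, a *: x + y) = a *: (0 : G, x) + (0 : G, y).
    by rewrite /relmul /= E; exact: tau_lin.
  by apply/eqP; rewrite xpair_eqE /= scaler0 addr0 !eqxx.
have Kcl : closed K.
  rewrite -KE => x cx; apply: tau_cl => B nB.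
  have : (fun z : G => (0 : G, z)) @ x --> (0 : G, x).
    by apply: cvg_pair => //; exact: cvg_cst.
  move=> /(_ _ nB) /cx [z [tz Bz]]; by exists (0, z).
pose W := exit_relation A Gam0 Gam1 iota At.
have brW : boundary_relation (range iota) W.
  exact: (exit_boundary_relation trip iotae sa AAt).
have weyl l h h' : nonreal l -> tau l (h, h') ->
    exists u, W u (l *: u) h h'.
  by move=> /comp; exact: exit_relation_weyl.
have Wtau0 l h : nonreal l -> exists u, W u (l *: u) (j h) (j (tau0 l h)).
  move=> l0; apply: weyl => //; rewrite tauE//; exists (h, tau0 l h) => //.
  by exists 0; [exact: Klin.1|rewrite /= addr0].
have WK k : K k -> W 0 0 0 k.
  rewrite -KE => /(weyl _ _ _ ni)[u Wu].
  by have u0 := boundary_relation_nonreal0 brW ni Wu; rewrite u0 scaler0 in Wu.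
have eig := eigenrelation brW je tau0_bd Wtau0 Klin Kcl jK WK Bcl.
have KN k : K k -> K (- k).
  by move=> Kk; have := Klin.2 (- 1) _ _ Kk Klin.1; rewrite scaleN1r addr0.
(* the sign in front of [B] is immaterial, its range being a subspace *)
have BN x : exists y, strong_limB tau0 t y = - strong_limB tau0 t x.
  have [B0 Blin] := linear_manifold_strong_limB (t := t) brW je tau0_bd Wtau0.
  have [|y _ yE] := Blin (- 1) (strong_limB tau0 t x) 0 _ B0; first by exists x.
  by exists y; rewrite yE scaleN1r addr0.
apply/seteqP; split=> f.
  move=> /(shtraus_exit_relation trip iotae sa AAt)[Af /eig].
  move=> [x [x0 [k [Dx Kk f0 f1]]]]; split=> //.
  have [y yE] := BN x0.
  exists x, y, (- k); split=> //; first exact: KN.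
  by rewrite f0 yE (embeddingN je) -!opprD -f1 opprK.
move=> [Af [x [x0 [k [Dx Kk [f0 f1]]]]]].
apply/(shtraus_exit_relation trip iotae sa AAt); split=> //; apply/eig.
have [y yE] := BN x0.
exists x, y, (- k); split=> //; first exact: KN.
by rewrite f1 yE (embeddingN je) !opprD opprK.
Qed.
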